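(* Let $f:\mathbb{R}^d\times\mathbb{R}^d\to\mathbb{R}$ be a twice continuously differentiable function such that everywhere $\|\nabla^2_{xx}f(x,y)\|_{\mathrm{op}}\le L_{xx}$, $\|\nabla^2_{xy}f(x,y)\|_{\mathrm{op}}\le L_{xy}$, $\|\nabla^2_{yy}f(x,y)\|_{\mathrm{op}}\le L_{yy}$, and such that $f(\cdot,y)$ is $\mu_x$-strongly convex for each $y$ and $f(x,\cdot)$ is $\mu_y$-strongly concave for each $x$, with $\mu_x,\mu_y>0$ (strong convexity in $\|\cdot\|_2$). Let $r(x,y)=\frac{\mu_x}2\|x\|_2^2+\frac{\mu_y}2\|y\|_2^2$ and $g(x,y)=(\nabla_xf(x,y),-\nabla_yf(x,y))$. Then with respect to $r$, $g$ is $1$-strongly monotone and $$\left(\frac{L_{xx}}{\mu_x}+\sqrt{\frac{L_{xy}^2}{\mu_x\mu_y}}+\frac{L_{yy}}{\mu_y}\right)\text{-relatively Lipschitz}.$$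
   Context: $\|\cdot\|_{\mathrm{op}}$ is the $\ell_2$ operator norm. Bregman divergence: $V^r_z(w)=r(w)-r(z)-\langle\nabla r(z),w-z\rangle$. On $\mathcal Z=\mathbb{R}^d\times\mathbb{R}^d$: $g$ is $m$-strongly monotone with respect to $r$ if $\langle g(w)-g(z),w-z\rangle\ge m(V^r_w(z)+V^r_z(w))$ for all $w,z\in\mathcal Z$; $g$ is $\lambda$-relatively Lipschitz with respect to $r$ if $\langle g(w)-g(z),w-u\rangle\le\lambda(V^r_z(w)+V^r_w(u))$ for all $z,w,u\in\mathcal Z$. *)

(* Defs.v *)
From HB Require Import structures.
From mathcomp Require Import all_boot all_order all_algebra.
From mathcomp Require Import boolp classical_sets reals topology normedtype derive.

Set Implicit Arguments.
Unset Strict Implicit.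
Unset Printing Implicit Defensive.
Import Order.TTheory GRing.Theory Num.Theory.
Import numFieldNormedType.Exports.

Local Open Scope classical_set_scope.
Local Open Scope ring_scope.

(* The norm that the library puts on ['cV[R]_n] is the sup norm; it is only used
   for its topology (and for differentiability). The Euclidean structure is the
   one defined below. *)
Definition dotv {R : realType} {n : nat} (u v : 'cV[R]_n) : R :=
  \sum_(i < n) u i ord0 * v i ord0.

Definition l2norm {R : realType} {n : nat} (u : 'cV[R]_n) : R :=
  Num.sqrt (dotv u u).

Definition l2opnorm {R : realType} {m n : nat} (A : 'M[R]_(m, n)) : R :=
  sup [set l2norm (A *m v) | v in [set v : 'cV[R]_n | l2norm v <= 1]].

Definition strongly_convex {R : realType} {n : nat} (mu : R)
    (h : 'cV[R]_n -> R) : Prop :=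
  forall (x y : 'cV[R]_n) (t : R), 0 <= t <= 1 ->
    h (t *: x + (1 - t) *: y) <=
    t * h x + (1 - t) * h y - mu / 2 * (t * (1 - t)) * l2norm (x - y) ^+ 2.

Definition strongly_concave {R : realType} {n : nat} (mu : R)
    (h : 'cV[R]_n -> R) : Prop :=
  strongly_convex mu (fun x => - h x).

(* For finite-dimensional [V], the second clause says that the differential of
   [f], seen as a map into the finite-dimensional space of linear forms, is
   itself differentiable, and the third one that the second differential is
   continuous. *)
Definition twice_continuously_differentiable {R : realType}
    {V : normedModType R} (f : V -> R) : Prop :=
  [/\ forall z : V, differentiable f z,
      forall v z : V, differentiable (fun z' : V => 'D_v f z') z &
      forall v w : V, continuous (fun z : V => 'D_w (fun z' : V => 'D_v f z') z)].

Section ProductSpace.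
Context {R : realType} {d : nat}.
Local Notation Z := ('cV[R]_d * 'cV[R]_d)%type.

Definition dotz (a b : Z) : R := dotv a.1 b.1 + dotv a.2 b.2.

Definition dirx (i : 'I_d) : Z := (delta_mx i ord0, 0).
Definition diry (i : 'I_d) : Z := (0, delta_mx i ord0).

Definition gradx (f : Z -> R) (z : Z) : 'cV[R]_d := \col_i 'D_(dirx i) f z.
Definition grady (f : Z -> R) (z : Z) : 'cV[R]_d := \col_i 'D_(diry i) f z.
Definition gradz (f : Z -> R) (z : Z) : Z := (gradx f z, grady f z).

Definition hessxx (f : Z -> R) (z : Z) : 'M[R]_d :=
  \matrix_(i, j) 'D_(dirx j) (fun z' : Z => 'D_(dirx i) f z') z.
Definition hessxy (f : Z -> R) (z : Z) : 'M[R]_d :=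
  \matrix_(i, j) 'D_(diry j) (fun z' : Z => 'D_(dirx i) f z') z.
Definition hessyy (f : Z -> R) (z : Z) : 'M[R]_d :=
  \matrix_(i, j) 'D_(diry j) (fun z' : Z => 'D_(diry i) f z') z.

(* [bregman r z w] is $V^r_z(w)$: the base point comes first. *)
Definition bregman (r : Z -> R) (z w : Z) : R :=
  r w - r z - dotz (gradz r z) (w - z).

Definition strongly_monotone (m : R) (r : Z -> R) (g : Z -> Z) : Prop :=
  forall w z : Z,
    m * (bregman r w z + bregman r z w) <= dotz (g w - g z) (w - z).

Definition relatively_lipschitz (lambda : R) (r : Z -> R) (g : Z -> Z) : Prop :=
  forall z w u : Z,
    dotz (g w - g z) (w - u) <= lambda * (bregman r z w + bregman r w u).

Definition quad_reg (mux muy : R) (z : Z) : R :=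
  mux / 2 * l2norm z.1 ^+ 2 + muy / 2 * l2norm z.2 ^+ 2.

Definition minimax_op (f : Z -> R) (z : Z) : Z := (gradx f z, - grady f z).

End ProductSpace.

(* Main.v *)
Require Import Defs.
From HB Require Import structures.
From mathcomp Require Import all_boot all_order all_algebra.
From mathcomp Require Import boolp classical_sets reals topology normedtype derive.
From mathcomp Require Import functions ring lra.

Set Implicit Arguments.
Unset Strict Implicit.
Unset Printing Implicit Defensive.
Import Order.TTheory GRing.Theory Num.Theory.
Import numFieldNormedType.Exports.

Local Open Scope classical_set_scope.
Local Open Scope ring_scope.

(** Strong monotonicity is the sum of the four first-order strong convexity
    inequalities of [f(., y)] and [- f(x, .)] between the corners of the
    rectangle spanned by [w] and [z]. For the relative Lipschitz bound, put
    [a = w - z], [b = w - u] and [c = (b.1, - b.2)]: since [<g p, b>] is the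
    derivative of [f] at [p] along [c], the mean value theorem on the segment
    from [z] to [w] reduces the claim to a bound on the second derivative
    ['D_a ('D_c f)], which Cauchy-Schwarz and Young's inequality give block by
    block. The symmetry of second derivatives makes the [yx] block the transpose
    of the [xy] block. *)

(** * Euclidean inner product and the operator norm as a bound on bilinear forms *)

Section Euclidean.
Context {R : realType}.

Lemma dotvC n (u v : 'cV[R]_n) : dotv u v = dotv v u.
Proof. by apply: eq_bigr => i _; rewrite mulrC. Qed.

Lemma dotvDl n (u v w : 'cV[R]_n) : dotv (u + v) w = dotv u w + dotv v w.
Proof. by rewrite /dotv -big_split; apply: eq_bigr => i _; rewrite !mxE mulrDl. Qed.

Lemma dotvZl n k (u v : 'cV[R]_n) : dotv (k *: u) v = k * dotv u v.
Proof. by rewrite /dotv mulr_sumr; apply: eq_bigr => i _; rewrite !mxE mulrA. Qed.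

Lemma dotvDr n (u v w : 'cV[R]_n) : dotv w (u + v) = dotv w u + dotv w v.
Proof. by rewrite dotvC dotvDl !(dotvC w). Qed.

Lemma dotvZr n k (u v : 'cV[R]_n) : dotv u (k *: v) = k * dotv u v.
Proof. by rewrite dotvC dotvZl dotvC. Qed.

Lemma dotvNl n (u v : 'cV[R]_n) : dotv (- u) v = - dotv u v.
Proof. by rewrite -scaleN1r dotvZl mulN1r. Qed.

Lemma dotvNr n (u v : 'cV[R]_n) : dotv u (- v) = - dotv u v.
Proof. by rewrite dotvC dotvNl dotvC. Qed.

Definition dotvE := (dotvDl, dotvDr, dotvNl, dotvNr, dotvZl, dotvZr).

Lemma dotv_ge0 n (u : 'cV[R]_n) : 0 <= dotv u u.
Proof. by apply: sumr_ge0 => i _; rewrite -expr2 sqr_ge0. Qed.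

Lemma l2norm_ge0 n (u : 'cV[R]_n) : 0 <= l2norm u.
Proof. exact: sqrtr_ge0. Qed.

Lemma l2norm_sqr n (u : 'cV[R]_n) : l2norm u ^+ 2 = dotv u u.
Proof. by rewrite sqr_sqrtr // dotv_ge0. Qed.

Lemma l2normZ n k (u : 'cV[R]_n) : l2norm (k *: u) = `|k| * l2norm u.
Proof.
by rewrite /l2norm !dotvE mulrA -expr2 sqrtrM ?sqr_ge0 // sqrtr_sqr.
Qed.

Lemma l2norm_eq0 n (u : 'cV[R]_n) : l2norm u = 0 -> u = 0.
Proof.
move=> u0; have : dotv u u = 0 by rewrite -l2norm_sqr u0 expr0n.
move=> /eqP; rewrite psumr_eq0 => [|i _]; last by rewrite -expr2 sqr_ge0.
move=> /allP u_eq0; apply/colP => i; rewrite mxE.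
have := u_eq0 i (mem_index_enum i).
by rewrite -expr2 sqrf_eq0 => /eqP.
Qed.

Lemma dotv0 n (u : 'cV[R]_n) : dotv u 0 = 0.
Proof. by rewrite -[0](scale0r u) dotvZr mul0r. Qed.

(** Cauchy-Schwarz: the squared norm of [l2norm v *: u - l2norm u *: v] is
    [2 * (l2norm u * l2norm v)] times the difference of the two sides, so away from the zero vectors
    that factor can be divided out. *)
Lemma dotv_le_l2norm n (u v : 'cV[R]_n) : dotv u v <= l2norm u * l2norm v.
Proof.
have [/l2norm_eq0 ->|u_neq0] := eqVneq (l2norm u) 0.
  by rewrite dotvC dotv0 mulr_ge0 ?l2norm_ge0.
have [/l2norm_eq0 ->|v_neq0] := eqVneq (l2norm v) 0.
  by rewrite dotv0 mulr_ge0 ?l2norm_ge0.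
have uv_gt0 : 0 < l2norm u * l2norm v.
  by rewrite mulr_gt0 // lt_neqAle eq_sym ?u_neq0 ?v_neq0 l2norm_ge0.
have := dotv_ge0 (l2norm v *: u - l2norm u *: v).
rewrite !dotvE (dotvC v u) -!l2norm_sqr => uv_ge0.
rewrite -subr_ge0 -(pmulr_rge0 _ uv_gt0); lra.
Qed.

Lemma l2normN n (u : 'cV[R]_n) : l2norm (- u) = l2norm u.
Proof. by rewrite -scaleN1r l2normZ normrN1 mul1r. Qed.

Lemma norm_dotv_le n (u v : 'cV[R]_n) : `|dotv u v| <= l2norm u * l2norm v.
Proof.
by rewrite ler_norml dotv_le_l2norm andbT lerNl -dotvNl -(l2normN u) dotv_le_l2norm.
Qed.

(** Cauchy-Schwarz on each row gives the Frobenius bound. Its purpose is to show that the set under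
    the [sup] in [l2opnorm] is bounded above, so that this [sup] is a true supremum and not a
    default value. *)
Lemma l2norm_mulmx_le m n (A : 'M[R]_(m, n)) (v : 'cV[R]_n) :
  l2norm (A *m v) <= Num.sqrt (\sum_i dotv (row i A)^T (row i A)^T) * l2norm v.
Proof.
have S_ge0 : 0 <= \sum_i dotv (row i A)^T (row i A)^T.
  by apply: sumr_ge0 => i _; exact: dotv_ge0.
rewrite -(@ler_pXn2r _ 2) ?nnegrE ?mulr_ge0 ?l2norm_ge0 ?sqrtr_ge0 //.
rewrite exprMn [leLHS]l2norm_sqr (sqr_sqrtr S_ge0) mulr_suml.
apply: ler_sum => i _; have -> : (A *m v) i ord0 = dotv (row i A)^T v.
  by rewrite mxE; apply: eq_bigr => j _; rewrite !mxE.
rewrite -expr2 -l2norm_sqr -exprMn -real_normK ?num_real //.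
by rewrite ler_pXn2r ?nnegrE ?mulr_ge0 ?l2norm_ge0 // norm_dotv_le.
Qed.

Lemma l2opnorm_ge m n (A : 'M[R]_(m, n)) (v : 'cV[R]_n) :
  l2norm v <= 1 -> l2norm (A *m v) <= l2opnorm A.
Proof.
move=> v1; apply: ub_le_sup; last by exists v.
exists (Num.sqrt (\sum_i dotv (row i A)^T (row i A)^T)) => _ [w w1 <-].
apply: (le_trans (l2norm_mulmx_le _ _)).
by rewrite ler_piMr ?sqrtr_ge0.
Qed.

Lemma l2norm0 n : l2norm (0 : 'cV[R]_n) = 0.
Proof. by rewrite /l2norm dotv0 sqrtr0. Qed.

Lemma l2opnorm_ge0 m n (A : 'M[R]_(m, n)) : 0 <= l2opnorm A.
Proof.
apply: (le_trans (l2norm_ge0 (A *m 0))).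
by apply: l2opnorm_ge; rewrite l2norm0.
Qed.

(** By homogeneity it suffices to apply [l2opnorm_ge] to the unit vector in the direction of [v]. *)
Lemma l2norm_mulmx m n (A : 'M[R]_(m, n)) (v : 'cV[R]_n) :
  l2norm (A *m v) <= l2opnorm A * l2norm v.
Proof.
have [/l2norm_eq0 ->|v_neq0] := eqVneq (l2norm v) 0.
  by rewrite mulmx0 !l2norm0 mulr0.
have v_gt0 : 0 < l2norm v by rewrite lt_neqAle eq_sym v_neq0 l2norm_ge0.
have := @l2opnorm_ge _ _ A ((l2norm v)^-1 *: v).
rewrite -scalemxAr !l2normZ ger0_norm ?invr_ge0 ?l2norm_ge0 // mulVf //.
by move=> /(_ (lexx _)); rewrite mulrC ler_pdivrMr.
Qed.

Lemma norm_dotv_mulmx_le m n (A : 'M[R]_(m, n)) u v :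
  `|dotv u (A *m v)| <= l2opnorm A * (l2norm u * l2norm v).
Proof.
apply: (le_trans (norm_dotv_le _ _)).
by rewrite mulrCA ler_wpM2l ?l2norm_ge0 // l2norm_mulmx.
Qed.

Lemma dotv_mulmx_tr m n (A : 'M[R]_(m, n)) u v :
  dotv u (A^T *m v) = dotv v (A *m u).
Proof.
rewrite /dotv; under eq_bigr do rewrite mxE mulr_sumr.
rewrite exchange_big; apply: eq_bigr => i _.
by rewrite mxE mulr_sumr; apply: eq_bigr => j _; rewrite mxE; ring.
Qed.

End Euclidean.

(** * Mean values along lines and the symmetry of second derivatives *)

Section Lines.
Context {R : realType} {V : normedModType R}.
Implicit Types (f : V -> R) (z v w : V).

(** The two difference quotients are the same function of [h], so no chain rule is involved and
    derivability in the single direction [v] suffices. *)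
Lemma is_derive_line f z v (t : R) : derivable f (z + t *: v) v ->
  is_derive t 1 (fun s : R => f (z + s *: v)) ('D_v f (z + t *: v)).
Proof.
have E : (fun h : R => h^-1 *: (((fun s : R => f (z + s *: v)) \o shift t) (h *: 1)
             - f (z + t *: v))) =
         (fun h : R => h^-1 *: ((f \o shift (z + t *: v)) (h *: v) - f (z + t *: v))).
  apply/funext => h /=; congr (_ *: (f _ - _)).
  by rewrite /= scalerDl [h%:A]mulr1 addrCA.
by move=> fzv; split; rewrite /derivable /derive E.
Qed.

Lemma MVT0 (phi dphi : R -> R) (h : R) : 0 < h ->
  (forall t : R, is_derive t 1 phi (dphi t)) ->
  exists2 t, 0 < t < h & phi h - phi 0 = dphi t * h.
Proof.
move=> h_gt0 dphiP; have cphi : {within `[0, h], continuous phi}.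
  by apply: derivable_within_continuous => t _; case: (dphiP t).
have [t] := MVT h_gt0 (fun t _ => dphiP t) cphi.
by rewrite in_itv subr0 => t_itv ->; exists t.
Qed.

(** The mean value theorem is applied twice: first along [v], to the increment of [f] under the
    shift by [h *: w], then along [w], to ['D_v f]. *)
Lemma second_difference f v w z (h : R) : 0 < h ->
  (forall z', derivable f z' v) -> (forall z', derivable ('D_v f) z' w) ->
  exists s t : R, [/\ 0 < s < h, 0 < t < h &
    f (z + h *: v + h *: w) - f (z + h *: v) - f (z + h *: w) + f z =
    'D_w ('D_v f) (z + s *: v + t *: w) * h * h].
Proof.
move=> h_gt0 fv fvw.
have [|s s_itv Es] := @MVT0
    (fun s => f (z + h *: w + s *: v) - f (z + s *: v))
    (fun s => 'D_v f (z + h *: w + s *: v) - 'D_v f (z + s *: v)) h h_gt0.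
  by move=> s; apply: is_deriveB; apply: is_derive_line.
have [|t t_itv Et] := @MVT0 (fun t => 'D_v f (z + s *: v + t *: w))
    (fun t => 'D_w ('D_v f) (z + s *: v + t *: w)) h h_gt0.
  by move=> t; apply: is_derive_line.
exists s, t; split => //; rewrite -Et scale0r addr0 (addrAC z (s *: v)) -Es.
by rewrite !scale0r !addr0 (addrAC z (h *: w)); ring.
Qed.

(** The second difference is symmetric in [v] and [w]. Evaluated in both orders by
    [second_difference], it equates the two mixed derivatives at two points close to [z], and
    continuity carries the equality to [z]. *)
Lemma schwarz f v w z :
  (forall z', derivable f z' v) -> (forall z', derivable f z' w) ->
  (forall z', derivable ('D_v f) z' w) -> (forall z', derivable ('D_w f) z' v) ->
  {for z, continuous ('D_w ('D_v f))} -> {for z, continuous ('D_v ('D_w f))} ->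
  'D_w ('D_v f) z = 'D_v ('D_w f) z.
Proof.
move=> fv fw fvw fwv cvw cwv; apply/eqP; rewrite -subr_eq0 -normr_le0.
apply/ler_addgt0Pr => e e_gt0; rewrite add0r.
have e2_gt0 : 0 < e / 2 by rewrite divr_gt0.
have /cvgrPdist_le/(_ _ e2_gt0)/nbhs_normP[d1 /= d1_gt0 D1] := cvw.
have /cvgrPdist_le/(_ _ e2_gt0)/nbhs_normP[d2 /= d2_gt0 D2] := cwv.
(* With [h * M = Num.min d1 d2], every intermediate point lies within both radii of [z]; the [1]
   keeps [M] positive and makes the estimate strict. *)
pose M := `|v| + `|w| + 1.
have M_gt0 : 0 < M by rewrite ltr_wpDl ?addr_ge0.
pose h := Num.min d1 d2 / M.
have d_gt0 : 0 < Num.min d1 d2 by rewrite lt_min d1_gt0.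
have h_gt0 : 0 < h by rewrite divr_gt0.
have close (s t : R) a b : 0 < s < h -> 0 < t < h -> a = v /\ b = w \/ a = w /\ b = v ->
    `|z - (z + s *: a + t *: b)| < Num.min d1 d2.
  move=> /andP[s0 sh] /andP[t0 th] ab; rewrite -addrA opprD addNKr normrN.
  apply: (le_lt_trans (ler_normD _ _)); rewrite !normrZ !gtr0_norm //.
  have -> : Num.min d1 d2 = h * M by rewrite /h divfK // gt_eqF.
  apply: (@le_lt_trans _ _ (h * `|a| + h * `|b|)).
    by rewrite lerD // ler_wpM2r // ltW.
  rewrite -mulrDr ltr_pM2l // /M.
  by case: ab => -[-> ->]; rewrite ?[_ + `|v|]addrC ltrDl.
have [s [t [s_itv t_itv E1]]] := second_difference z h_gt0 fv fvw.
have [t' [s' [t'_itv s'_itv E2]]] := second_difference z h_gt0 fw fwv.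
have {}D1 : `|'D_w ('D_v f) z - 'D_w ('D_v f) (z + s *: v + t *: w)| <= e / 2.
  apply: D1; apply: lt_le_trans (_ : Num.min d1 d2 <= d1); last by rewrite ge_min lexx.
  by apply: close => //; left.
have {}D2 :
    `|'D_v ('D_w f) z - 'D_v ('D_w f) (z + t' *: w + s' *: v)| <= e / 2.
  apply: D2; apply: lt_le_trans (_ : Num.min d1 d2 <= d2).
    by apply: close => //; right.
  by rewrite ge_min lexx orbT.
move: ('D_w _ (z + _ + _)) ('D_v _ (z + _ + _)) E1 E2 D1 D2 => A B E1 E2 D1 D2.
have E : A = B.
  have h_neq0 : h != 0 by rewrite gt_eqF.
  apply: (mulIf h_neq0); apply: (mulIf h_neq0); rewrite -E1 -E2.
  by rewrite (addrAC z (h *: w)); ring.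
move: D1; rewrite E => D1; rewrite -(subrKA B).
apply: (le_trans (ler_normD _ _)); rewrite (splitr e) lerD //.
by rewrite distrC; exact: D2.
Qed.

End Lines.

(** For [0 < h <= 1] the hypothesis bounds the difference quotient at [0] by
    [psi 1 - psi 0 - c * (1 - h)]; then [h] tends to [0] from the right. *)
Lemma derive_le_strong_convex (R : realType) (psi : R -> R) (c : R) :
  derivable psi 0 1 ->
  (forall t, 0 <= t <= 1 ->
     psi t <= t * psi 1 + (1 - t) * psi 0 - c * (t * (1 - t))) ->
  'D_1 psi 0 <= psi 1 - psi 0 - c.
Proof.
move=> dpsi psi_cvx.
have lc : (fun h : R => h^-1 *: ((psi \o shift 0) (h *: 1) - psi 0)) @ 0^'+ -->
    'D_1 psi 0.
  exact: cvg_dnbhs_at_right dpsi.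
have rc : (fun h : R => psi 1 - psi 0 - c * (1 - h)) @ 0^'+ --> psi 1 - psi 0 - c.
  have -> : psi 1 - psi 0 - c = psi 1 - psi 0 - c * (1 - 0) by ring.
  apply: cvg_at_right_filter; apply: cvgB; first exact: cvg_cst.
  by apply: cvgM; [exact: cvg_cst|apply: cvgB; [exact: cvg_cst|exact: cvg_id]].
apply: (ler_cvg_to lc rc); near=> h.
have h_gt0 : 0 < h by [].
have h_le1 : h <= 1 by near: h; exact: nbhs_right_le.
have := psi_cvx h; rewrite ltW // h_le1 => /(_ isT) psi_h.
rewrite /= [h%:A]mulr1 addr0 [_ *: _]mulrC ler_pdivrMr //; lra.
Unshelve. all: by end_near. Qed.

(** * Gradients, Hessian blocks and the two properties of the operator *)

Section ProductSpace.
Context {R : realType} {d : nat}.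
Local Notation Z := ('cV[R]_d * 'cV[R]_d)%type.
Implicit Types (f : Z -> R) (z w u a c : Z).

Lemma dotzBl z w a : dotz (z - w) a = dotz z a - dotz w a.
Proof. by rewrite /dotz !dotvDl !dotvNl opprD addrACA. Qed.

Lemma dir_sum a :
  a = \sum_i a.1 i ord0 *: dirx i + \sum_i a.2 i ord0 *: diry i.
Proof.
have delta_sum (v : 'cV[R]_d) : \sum_i v i ord0 *: delta_mx i ord0 = v.
  rewrite [RHS]matrix_sum_delta; apply: eq_bigr => i _.
  by rewrite big_ord1.
apply: injective_projections.
  rewrite raddfD !raddf_sum /= [X in _ + X]big1 ?addr0 ?delta_sum // => i _.
  by rewrite scaler0.
rewrite raddfD !raddf_sum /= [X in X + _]big1 ?add0r ?delta_sum // => i _.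
by rewrite scaler0.
Qed.

Lemma derive_dotz f z a : differentiable f z -> 'D_a f z = dotz (gradz f z) a.
Proof.
move=> fz; rewrite deriveE // {1}(dir_sum a) linearD !linear_sum /dotz /dotv.
by congr (_ + _); apply: eq_bigr => i _; rewrite linearZ /= mxE deriveE // mulrC.
Qed.

Lemma derive_quad_reg (mux muy : R) z a :
  'D_a (quad_reg mux muy) z = mux * dotv z.1 a.1 + muy * dotv z.2 a.2.
Proof.
apply: cvg_lim => //.
set D := mux * _ + _.
(* Since [quad_reg] is a quadratic form, its difference quotient along [a] is exactly this affine
   function of [h] for [h != 0]. *)
have : (fun h : R => D + h * quad_reg mux muy a) @ 0^' --> D.
  have {2}-> : D = D + 0 * quad_reg mux muy a by ring.
  apply: cvg_within_filter; apply: cvgD; first exact: cvg_cst.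
  by apply: cvgM; [exact: cvg_id|exact: cvg_cst].
apply: cvg_trans; apply: near_eq_cvg; near=> h.
have h_neq0 : h != 0 by near: h; exact: nbhs_dnbhs_neq.
rewrite /D /quad_reg /= !l2norm_sqr !dotvE (dotvC a.1) (dotvC a.2).
by rewrite [_ *: _]mulrC; field.
Unshelve. all: by end_near. Qed.

Lemma bregman_quad_reg (mux muy : R) z w :
  bregman (quad_reg mux muy) z w =
  mux / 2 * l2norm (w.1 - z.1) ^+ 2 + muy / 2 * l2norm (w.2 - z.2) ^+ 2.
Proof.
have Ex : gradx (quad_reg mux muy) z = mux *: z.1.
  apply/colP => i; rewrite !mxE derive_quad_reg /= dotv0 mulr0 addr0.
  rewrite /dotv (bigD1 i) //= big1 => [|j /negPf ji]; rewrite !mxE ?ji ?mulr0 //.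
  by rewrite !eqxx mulr1 addr0.
have Ey : grady (quad_reg mux muy) z = muy *: z.2.
  apply/colP => i; rewrite !mxE derive_quad_reg /= dotv0 mulr0 add0r.
  rewrite /dotv (bigD1 i) //= big1 => [|j /negPf ji]; rewrite !mxE ?ji ?mulr0 //.
  by rewrite !eqxx mulr1 addr0.
rewrite /bregman /dotz /= Ex Ey /quad_reg !l2norm_sqr !dotvE.
by rewrite (dotvC w.1 z.1) (dotvC w.2 z.2); field.
Qed.

(** First-order form of strong convexity: restrict [f] to the segment from [z] to [(x, z.2)] and
    apply [derive_le_strong_convex] with [c = mu / 2 * l2norm (x - z.1) ^+ 2]. *)
Lemma strongly_convex_gradx f mu z x : differentiable f z ->
  strongly_convex mu (fun x => f (x, z.2)) ->
  dotv (gradx f z) (x - z.1) <= f (x, z.2) - f z - mu / 2 * l2norm (x - z.1) ^+ 2.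
Proof.
move=> fz f_cvx; set a : Z := (x - z.1, 0).
have Eline (t : R) : z + t *: a = (t *: x + (1 - t) *: z.1, z.2).
  apply: injective_projections => /=; last by rewrite scaler0 addr0.
  by rewrite scalerBr scalerBl scale1r addrCA.
have E1 : f (x, z.2) = f (z + 1 *: a).
  by rewrite Eline subrr scale0r addr0 scale1r.
have E0 : f z = f (z + 0 *: a) by rewrite scale0r addr0.
have dline : is_derive (0 : R) 1 (fun s : R => f (z + s *: a)) ('D_a f z).
  have -> : 'D_a f z = 'D_a f (z + (0 : R) *: a) by rewrite scale0r addr0.
  by apply: is_derive_line; rewrite scale0r addr0; exact: diff_derivable.
have -> : dotv (gradx f z) (x - z.1) = 'D_a f z.
  by have := derive_dotz a fz; rewrite /dotz [X in _ + X]dotv0 addr0.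
case: dline => dline <-.
rewrite E1 E0; apply: derive_le_strong_convex => // t t01.
rewrite -E1 -E0 Eline (le_trans (f_cvx _ _ _ t01)) //.
by rewrite -surjective_pairing; lra.
Qed.

(** The same argument for [- f] on the segment from [z] to [(z.1, y)]. *)
Lemma strongly_concave_grady f mu z y : differentiable f z ->
  strongly_concave mu (fun y => f (z.1, y)) ->
  mu / 2 * l2norm (y - z.2) ^+ 2 <= f z - f (z.1, y) + dotv (grady f z) (y - z.2).
Proof.
move=> fz f_ccv; set a : Z := (0, y - z.2).
have Eline (t : R) : z + t *: a = (z.1, t *: y + (1 - t) *: z.2).
  apply: injective_projections => /=; first by rewrite scaler0 addr0.
  by rewrite scalerBr scalerBl scale1r addrCA.
have E1 : f (z.1, y) = f (z + 1 *: a).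
  by rewrite Eline subrr scale0r addr0 scale1r.
have E0 : f z = f (z + 0 *: a) by rewrite scale0r addr0.
have dline : is_derive (0 : R) 1 (fun s : R => - f (z + s *: a)) (- 'D_a f z).
  have -> : 'D_a f z = 'D_a f (z + (0 : R) *: a) by rewrite scale0r addr0.
  apply: is_deriveN; apply: is_derive_line; rewrite scale0r addr0.
  exact: diff_derivable.
have Ea : dotv (grady f z) (y - z.2) = 'D_a f z.
  by have := derive_dotz a fz; rewrite /dotz [X in X + _]dotv0 add0r.
case: dline => dline D0.
have /= := @derive_le_strong_convex _ _ (mu / 2 * l2norm (y - z.2) ^+ 2) dline.
rewrite D0 -E1 -E0 Ea => cvx_le.
suff /cvx_le : forall t : R, 0 <= t <= 1 -> - f (z + t *: a) <=
    t * - f (z.1, y) + (1 - t) * - f z -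
    mu / 2 * l2norm (y - z.2) ^+ 2 * (t * (1 - t)) by lra.
move=> t t01; rewrite Eline (le_trans (f_ccv _ _ _ t01)) //.
by rewrite -surjective_pairing; lra.
Qed.

Lemma minimax_op_strongly_monotone f (mux muy : R) :
  (forall z, differentiable f z) ->
  (forall y, strongly_convex mux (fun x => f (x, y))) ->
  (forall x, strongly_concave muy (fun y => f (x, y))) ->
  strongly_monotone 1 (quad_reg mux muy) (minimax_op f).
Proof.
move=> df f_cvx f_ccv w z; rewrite mul1r !bregman_quad_reg.
have Hwx := strongly_convex_gradx z.1 (df w) (f_cvx w.2).
have Hzx := strongly_convex_gradx w.1 (df z) (f_cvx z.2).
have Hwy := strongly_concave_grady z.2 (df w) (f_ccv w.1).
have Hzy := strongly_concave_grady w.2 (df z) (f_ccv z.1).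
move: Hwx Hzx Hwy Hzy; rewrite /dotz /minimax_op /= !l2norm_sqr.
(* Each corner value occurs twice with opposite signs and cancels in the sum. *)
move: (f w) (f z) (f (z.1, w.2)) (f (w.1, z.2)) => fw fz fzw fwz.
move: (gradx f w) (gradx f z) (grady f w) (grady f z) => gxw gxz gyw gyz.
by rewrite !dotvE; lra.
Qed.

(** Expanding ['D_c f] in partial derivatives and differentiating each of them along [a] yields the
    blocks; [schwarz] lets [(hessxy f z)^T] stand for the [yx] block. *)
Lemma derive2_hess f z a c : twice_continuously_differentiable f ->
  'D_a ('D_c f) z =
  dotv c.1 (hessxx f z *m a.1) + dotv c.1 (hessxy f z *m a.2) +
  (dotv c.2 ((hessxy f z)^T *m a.1) + dotv c.2 (hessyy f z *m a.2)).
Proof.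
move=> [df d2f c2f]; rewrite -dotvDr -[X in _ + X]dotvDr.
have sym i j : 'D_(dirx j) ('D_(diry i) f) z = 'D_(diry i) ('D_(dirx j) f) z.
  exact: (@schwarz _ _ f (diry i) (dirx j) z
    (fun z' => diff_derivable (df z')) (fun z' => diff_derivable (df z'))
    (fun z' => diff_derivable (d2f (diry i) z'))
    (fun z' => diff_derivable (d2f (dirx j) z')) (c2f _ _ z) (c2f _ _ z)).
have d2 v : derivable ('D_v f) z a by exact: diff_derivable.
have -> : 'D_c f = \sum_i (c.1 i ord0 *: 'D_(dirx i) f) +
                   \sum_i (c.2 i ord0 *: 'D_(diry i) f).
  apply/funext => z'; rewrite (derive_dotz c (df z')).
  by apply: (@f_equal2 R R R +%R); rewrite fct_sumE; apply: eq_bigr => i _; rewrite mxE mulrC.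
have dZ (k : R) v : derivable (k *: 'D_v f) z a by exact: derivableZ.
rewrite deriveD; [|exact: derivable_sum|exact: derivable_sum].
rewrite !derive_sum //; congr (_ + _); apply: eq_bigr => i _.
  rewrite deriveZ // derive_dotz // !mxE.
  congr (_ * (_ + _)); apply: eq_bigr => j _; rewrite !mxE //.
rewrite deriveZ // derive_dotz // !mxE.
congr (_ * (_ + _)); apply: eq_bigr => j _; rewrite !mxE; last by [].
by rewrite sym.
Qed.

Lemma minimax_op_relatively_lipschitz f (Lxx Lxy Lyy mux muy : R) :
  twice_continuously_differentiable f ->
  (forall z, l2opnorm (hessxx f z) <= Lxx) ->
  (forall z, l2opnorm (hessxy f z) <= Lxy) ->
  (forall z, l2opnorm (hessyy f z) <= Lyy) ->
  0 < mux -> 0 < muy ->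
  relatively_lipschitz
    (Lxx / mux + Num.sqrt (Lxy ^+ 2 / (mux * muy)) + Lyy / muy)
    (quad_reg mux muy) (minimax_op f).
Proof.
move=> f_C2 f_xx f_xy f_yy mux_gt0 muy_gt0 z w u; have [df d2f c2f] := f_C2.
pose a := w - z; pose b := w - u; pose c : Z := (b.1, - b.2).
have Eg z' : dotz (minimax_op f z') b = 'D_c f z'.
  rewrite (derive_dotz c (df z')) /dotz.
  by rewrite [X in _ + X = _]dotvNl [X in _ = _ + X]dotvNr.
have [t _ Et] := @MVT0 R (fun t => 'D_c f (z + t *: a))
  (fun t => 'D_a ('D_c f) (z + t *: a)) 1 ltr01
  (fun t => is_derive_line (diff_derivable (d2f c (z + t *: a)))).
have -> : dotz (minimax_op f w - minimax_op f z) (w - u) =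
    'D_a ('D_c f) (z + t *: a).
  by move: Et; rewrite scale0r scale1r addr0 mulr1 subrKC -!Eg -dotzBl.
have -> : bregman (quad_reg mux muy) w u =
    mux / 2 * l2norm b.1 ^+ 2 + muy / 2 * l2norm b.2 ^+ 2.
  by rewrite bregman_quad_reg -(l2normN b.1) -(l2normN b.2) !opprB.
have -> : bregman (quad_reg mux muy) z w =
    mux / 2 * l2norm a.1 ^+ 2 + muy / 2 * l2norm a.2 ^+ 2.
  exact: bregman_quad_reg.
(* Moving the transpose across the inner product puts the [yx] term in terms of [hessxy], so that
   [Lxy] bounds it too. *)
rewrite (derive2_hess _ _ _ f_C2) dotv_mulmx_tr.
have bound (A : 'M[R]_d) L x y : l2opnorm A <= L ->
    dotv x (A *m y) <= L * (l2norm x * l2norm y).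
  move=> AL; apply: le_trans (ler_norm _) _.
  apply: le_trans (norm_dotv_mulmx_le _ _ _) _.
  by rewrite ler_wpM2r // mulr_ge0 ?l2norm_ge0.
have Bxx := bound _ _ c.1 a.1 (f_xx (z + t *: a)).
have Bxy := bound _ _ c.1 a.2 (f_xy (z + t *: a)).
have Byx := bound _ _ a.1 c.2 (f_xy (z + t *: a)).
have Byy := bound _ _ c.2 a.2 (f_yy (z + t *: a)).
(* The three constants are nonnegative because each dominates an operator norm. *)
have Lxx_ge0 := le_trans (l2opnorm_ge0 _) (f_xx z).
have Lxy_ge0 := le_trans (l2opnorm_ge0 _) (f_xy z).
have Lyy_ge0 := le_trans (l2opnorm_ge0 _) (f_yy z).
apply: le_trans (lerD (lerD Bxx Bxy) (lerD Byx Byy)) _.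
rewrite /= !l2normN.
move: (l2norm a.1) (l2norm a.2) (l2norm b.1) (l2norm b.2) => a1 a2 b1 b2.
(* In terms of [p] and [q] the constant is a rational expression, within reach of [field]. *)
pose p := Num.sqrt mux; pose q := Num.sqrt muy.
have p_gt0 : 0 < p by rewrite sqrtr_gt0.
have q_gt0 : 0 < q by rewrite sqrtr_gt0.
have Emux : mux = p ^+ 2 by rewrite sqr_sqrtr // ltW.
have Emuy : muy = q ^+ 2 by rewrite sqr_sqrtr // ltW.
have -> : Num.sqrt (Lxy ^+ 2 / (mux * muy)) = Lxy / (p * q).
  by rewrite Emux Emuy -exprMn -expr_div_n sqrtr_sqr ger0_norm // divr_ge0 // ltW ?mulr_gt0.
rewrite Emux Emuy -subr_ge0.
(* Young's inequality in exact form. The diagonal terms use equal weights, and the cross terms pair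
   [p * b1] with [q * a2] and [p * a1] with [q * b2]. The terms in [q / p] and [p / q] are the
   surplus of [Lxx / mux] on the [y] part and of [Lyy / muy] on the [x] part. *)
have -> : (Lxx / p ^+ 2 + Lxy / (p * q) + Lyy / q ^+ 2) *
    (p ^+ 2 / 2 * a1 ^+ 2 + q ^+ 2 / 2 * a2 ^+ 2 +
     (p ^+ 2 / 2 * b1 ^+ 2 + q ^+ 2 / 2 * b2 ^+ 2)) -
    (Lxx * (b1 * a1) + Lxy * (b1 * a2) + (Lxy * (a1 * b2) + Lyy * (b2 * a2))) =
  Lxx / 2 * ((a1 - b1) ^+ 2 + (q / p) ^+ 2 * (a2 ^+ 2 + b2 ^+ 2)) +
  Lxy / (p * q) / 2 * ((p * b1 - q * a2) ^+ 2 + (p * a1 - q * b2) ^+ 2) +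
  Lyy / 2 * ((a2 - b2) ^+ 2 + (p / q) ^+ 2 * (a1 ^+ 2 + b1 ^+ 2)).
  by field; rewrite !gt_eqF.
have [p_ge0 q_ge0] := (ltW p_gt0, ltW q_gt0).
by rewrite !(sqr_ge0, addr_ge0, mulr_ge0, invr_ge0, ler0n).
Qed.

End ProductSpace.

Theorem lemma17 (R : realType) (d : nat) (f : 'cV[R]_d * 'cV[R]_d -> R)
  (Lxx Lxy Lyy mux muy : R)
  (f_C2 : twice_continuously_differentiable f)
  (f_xx : forall x y : 'cV[R]_d, l2opnorm (hessxx f (x, y)) <= Lxx)
  (f_xy : forall x y : 'cV[R]_d, l2opnorm (hessxy f (x, y)) <= Lxy)
  (f_yy : forall x y : 'cV[R]_d, l2opnorm (hessyy f (x, y)) <= Lyy)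
  (mux_gt0 : 0 < mux) (muy_gt0 : 0 < muy)
  (f_cvx : forall y : 'cV[R]_d, strongly_convex mux (fun x => f (x, y)))
  (f_ccv : forall x : 'cV[R]_d, strongly_concave muy (fun y => f (x, y))) :
  strongly_monotone 1 (quad_reg mux muy) (minimax_op f) /\
  relatively_lipschitz
    (Lxx / mux + Num.sqrt (Lxy ^+ 2 / (mux * muy)) + Lyy / muy)
    (quad_reg mux muy) (minimax_op f).
Proof.
have [df _ _] := f_C2; split; first exact: (minimax_op_strongly_monotone df f_cvx f_ccv).
have f_xxz z : l2opnorm (hessxx f z) <= Lxx by case: z => x y; exact: f_xx.
have f_xyz z : l2opnorm (hessxy f z) <= Lxy by case: z => x y; exact: f_xy.
have f_yyz z : l2opnorm (hessyy f z) <= Lyy by case: z => x y; exact: f_yy.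
exact: (minimax_op_relatively_lipschitz f_C2 f_xxz f_xyz f_yyz mux_gt0 muy_gt0).
Qed.
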